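(* Let $A$ be a finite abelian group and $B$ a subgroup of $A$ of index $2$, and suppose that $(A,B)$ is not one of the pairs [$A\cong C_4\times C_2^\ell$ for some $\ell\ge1$ and $B\cong C_2^{\ell+1}$] or [$A\cong C_4^2\times C_2^\ell$ for some $\ell\ge0$ and $B\cong C_4\times C_2^{\ell+1}$]. Then the number of graphs $\mathrm{Cay}(A,S)$ with $S\subseteq A\setminus B$ and $S=S^{-1}$, counted up to graph isomorphism, equals $2^{\frac{|A|}{4}+\frac{|A_2\setminus B|}{2}+o(|A|)}$, where $o(|A|)$ denotes a quantity whose ratio with $|A|$ tends to $0$ as $|A|\to\infty$.
   Context: $C_t$ denotes the cyclic group of order $t$; $A_2:=\{a\in A\mid a^2=1\}$; $S^{-1}:=\{s^{-1}\mid s\in S\}$. For a finite group $G$ and $S\subseteq G$, the Cayley digraph $\mathrm{Cay}(G,S)$ has vertex set $G$ and an arc $(g,h)$ if and only if $gh^{-1}\in S$; it is an undirected graph when $S=S^{-1}$. These graphs with $S\subseteq A\setminus B$ are the bipartite Cayley graphs over $A$ with bipartition $\{B,A\setminus B\}$. *)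

(* Defs.v *)
From HB Require Import structures.
From mathcomp Require Import all_boot all_order all_algebra all_fingroup.
From mathcomp Require Import reals exp.

Set Implicit Arguments.
Unset Strict Implicit.
Unset Printing Implicit Defensive.

Local Open Scope group_scope.

Section Digraphs.
Variable V : finType.

(* A digraph on the vertex set V is its set of arcs. *)
Definition digraph := {set V * V}.

Definition digraph_iso (D E : digraph) : bool :=
  [exists f : {perm V}, forall x, forall y,
     ((x, y) \in D) == ((f x, f y) \in E)].

(* digraph_iso is an equivalence relation (digraph_iso_equivalence below), so
   the blocks of this partition are exactly the isomorphism classes in X. *)
Definition num_iso_classes (X : {set digraph}) : nat :=
  #|equivalence_partition digraph_iso X|.

Lemma digraph_iso_equivalence : equivalence_rel digraph_iso.
Proof.
have refl D : digraph_iso D D.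
  by apply/existsP; exists 1; apply/forallP=> x; apply/forallP=> y; rewrite !perm1.
have sym D E : digraph_iso D E -> digraph_iso E D.
  case/existsP=> f /forallP fP; apply/existsP; exists f^-1.
  apply/forallP=> x; apply/forallP=> y.
  by have /forallP/(_ (f^-1 y)) := fP (f^-1 x); rewrite !permKV eq_sym.
have trans D E F : digraph_iso D E -> digraph_iso E F -> digraph_iso D F.
  case/existsP=> f /forallP fP /existsP[g /forallP gP]; apply/existsP.
  exists (f * g); apply/forallP=> x; apply/forallP=> y; rewrite !permM.
  have /forallP/(_ y)/eqP-> := fP x; exact: (forallP (gP (f x)) (f y)).
move=> D E F; split=> // isoDE; apply/idP/idP; last exact: trans.
exact/trans/sym.
Qed.

End Digraphs.

Section Cayley.
Variable A : finGroupType.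

Definition Cay (S : {set A}) : digraph A :=
  [set gh : A * A | gh.1 * gh.2^-1 \in S].

Definition bipartite_Cayley_graphs (B : {group A}) : {set digraph A} :=
  [set Cay S | S : {set A} & (S \subset [set: A] :\: B) && (S == S^-1)].

Definition square_roots1 : {set A} := [set a | a ^+ 2 == 1].

(* In the two products below, 'Z_4, 'Z_2 and the row vectors carry their
   additive group structure: 'Z_t is C_t and 'rV['Z_2]_l is C_2^l. *)
Definition exceptional_pair (B : {group A}) : Prop :=
  (exists2 l : nat, (0 < l)%N &
     [set: A] \isog [set: 'Z_4 * 'rV['Z_2]_l]
     /\ B \isog [set: 'rV['Z_2]_l.+1])
  \/
  (exists l : nat,
     [set: A] \isog [set: 'Z_4 * 'Z_4 * 'rV['Z_2]_l]
     /\ B \isog [set: 'Z_4 * 'rV['Z_2]_l.+1]).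

Definition admissible_pair (B : {group A}) : Prop :=
  [/\ abelian [set: A], #|[set: A] : B| = 2 & ~ exceptional_pair B].

End Cayley.

(* Main.v *)
Require Import Defs.
From HB Require Import structures.
From mathcomp Require Import all_boot all_order all_algebra all_fingroup all_solvable.
From mathcomp Require Import reals exp.
From mathcomp Require Import zify ring lra.

Set Implicit Arguments.
Unset Strict Implicit.
Unset Printing Implicit Defensive.

Import Order.TTheory GRing.Theory Num.Theory.
Local Open Scope ring_scope.

(** Write n = |A|. The inverse-closed S inside A \ B are 2^(n/4 + |A_2 \ B|/2) in
number, which is the upper bound; so it suffices to show that for at least half
of these S only 2^(O(log^3 n)) sets S' give a graph isomorphic to Cay(A,S).

If some T of size O(log n) resolves Cay(A,S), i.e. distinct vertices have distinct
neighbourhoods in T, then an automorphism is determined by its values on T.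
An isomorphism f from Cay(A,S') to Cay(A,S) transports right multiplication
to an action of A on Cay(A,S), and this action together with f(1) determines f,
hence S'. The action is given by the images of at most log n generators, so there
are at most n (n^|T|)^(log n) such S'.

That a suitable T resolves most S is a union bound over pairs x <> y: each t in T
with t^2 <> xy imposes a condition "x/t in S iff y/t in S" which is not automatic, and
a fixed proportion of these conditions are independent. Taking T closed under a
shift t -> gt with g in B, g^2 <> 1, ensures that many t satisfy t^2 <> xy. Such a g is
missing only if B is an elementary 2-group; then either so is A, and t^2 = xy never
happens, or (A,B) is the first exceptional pair. *)

(** * Subgroups of index two *)

Section IndexTwo.
Local Open Scope group_scope.
Variables (A : finGroupType) (B : {group A}).
Hypothesis iB2 : #|[set: A] : B| = 2.

Lemma card_index2 : #|A| = (2 * #|B|)%N.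
Proof. by rewrite -cardsT -(Lagrange (subsetT B)) iB2 mulnC. Qed.

Lemma card_index2D : #|[set: A] :\: B| = #|B|.
Proof.
have := cardsC B; rewrite setTD card_index2 mul2n -addnn => /eqP.
by rewrite eqn_add2l => /eqP.
Qed.

Lemma index2_mem_mul x y : (x * y \in B) = ((x \in B) == (y \in B)).
Proof.
have [Bx|Bx] := boolP (x \in B); first by rewrite groupMl //; case: (y \in B).
have [By|By] := boolP (y \in B); first by rewrite groupMr //; exact: negbTE.
(* The coset [B :* y^-1] misses [B] and has as many elements as the complement of [B], so it is that
   complement. *)
have eqBy : B :* y^-1 = [set: A] :\: B.
  apply/eqP; rewrite eqEcard card_rcoset card_index2D leqnn andbT.
  apply/subsetP=> z; rewrite mem_rcoset invgK !inE andbT => Bzy.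
  by apply: contra By => Bz; rewrite -(groupMl y Bz).
have : x \in B :* y^-1 by rewrite eqBy !inE Bx.
by rewrite mem_rcoset invgK => ->.
Qed.

End IndexTwo.

(** * The exceptional pairs with [B] elementary abelian *)

Section ExceptionalPair.
Local Open Scope group_scope.

Lemma abelem2 (gT : finGroupType) (G : {group gT}) :
  (forall x, x \in G -> x ^+ 2 = 1) -> 2.-abelem G.
Proof.
move=> G2; apply/abelemP => //; split=> //; apply/centsP=> x Gx y Gy.
have inv z : z \in G -> z^-1 = z.
  by move=> Gz; apply/(mulgI z); rewrite mulgV -expg2 G2.
by apply/invg_inj; rewrite (inv _ (groupM Gx Gy)) invMg !inv.
Qed.

Lemma rV_Z2_abelem (l : nat) : 2.-abelem [set: 'rV['Z_2]_l].
Proof.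
apply: abelem2 => x _; apply/matrixP=> i j.
have -> : x ^+ 2 = (x + x)%R by rewrite expg2.
rewrite !mxE; case: (x i j) => [[|[|]]] //= p; exact/val_inj.
Qed.

Lemma card_rV_Z2 (l : nat) : #|[set: 'rV['Z_2]_l]| = (2 ^ l)%N.
Proof. by rewrite cardsT card_mx card_ord mul1n. Qed.

(** Some [a] has order 4 with its square in [B], and a complement [D] of [<[a ^+ 2]>] in the
    elementary abelian [B] is also a complement of [<[a]>] in [A]. The bound [4 < #|A|] makes [D]
    nontrivial, hence [0 < l]. *)
Lemma exceptional_pair_elementary (A : finGroupType) (B : {group A}) :
    abelian [set: A] -> #|[set: A] : B| = 2 -> (4 < #|A|)%N ->
    (forall b, b \in B -> b ^+ 2 = 1) -> (exists a : A, a ^+ 2 != 1) ->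
  exceptional_pair B.
Proof.
move=> cAA iB2 An4 B2 [a a2].
have oA := card_index2 iB2.
have EB : 2.-abelem B by exact: abelem2.
have Ba2 : a ^+ 2 \in B by rewrite expg2 index2_mem_mul.
have a4 : a ^+ 4 = 1 by rewrite (expgM a 2 2) B2.
have oa2 : #[a ^+ 2] = 2 by apply: nt_prime_order => //; exact: B2.
have oa : #[a] = 4.
  have := orderXdvd a 2; rewrite oa2 => da2.
  have : (#[a] %| 4)%N by rewrite order_dvdn a4.
  rewrite dvdn_divisors //= !inE => /or3P[] /eqP oa //; first by rewrite oa in da2.
  by move: a2; rewrite -order_dvdn oa.
have [D defB] : exists D : {group A}, <[a ^+ 2]> \x D = B.
  by apply: (abelem_split_dprod EB); rewrite cycle_subG.
have oB : #|B| = (2 * #|D|)%N by rewrite -(dprod_card defB) -orderE oa2.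
have [_ _ _ tiD] := dprodP defB.
have sDB : D \subset B by rewrite -(dprodW defB) mulG_subr.
(* Elements of [D] square to 1, so [a ^+ i] in [D] forces [i] to be even, and then [a ^+ i] lies in
   [<[a ^+ 2]>]. *)
have tiaD : <[a]> :&: D = 1.
  apply/trivgP/subsetP=> x /setIP[/cycleP[i ->] Dai]; rewrite -tiD inE Dai andbT.
  have : (#[a] %| i * 2)%N by rewrite order_dvdn expgM B2 ?(subsetP sDB).
  rewrite oa -[4]/(2 * 2)%N dvdn_pmul2r // => /dvdnP[j ->].
  by rewrite mulnC expgM mem_cycle.
have defA : <[a]> \x D = [set: A].
  rewrite dprodE //; last first.
    exact: subset_trans (subsetT _) (subset_trans cAA (centS (subsetT _))).
  apply/eqP; rewrite eqEcard subsetT cardsT TI_cardMg // -orderE oa oA oB.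
  by rewrite mulnA leqnn.
have [l oD] : exists l, #|D| = (2 ^ l)%N.
  by exists (logn 2 #|D|); apply/card_pgroup/(pgroupS sDB); case/and3P: EB.
left; exists l; last split.
- by case: l oD => // oD; move: An4; rewrite oA oB oD.
- have -> : [set: 'Z_4 * 'rV['Z_2]_l] = setX [set: 'Z_4] [set: 'rV['Z_2]_l].
    by apply/setP=> -[u v]; rewrite !inE.
  apply: (isog_dprod defA (setX_dprod [set: 'Z_4]%G [set: 'rV['Z_2]_l]%G)).
    apply: isog_trans (isog_setX1 _ _).
    rewrite isog_cyclic_card ?cycle_cyclic // cardsT card_ord -orderE oa andbT.
    by apply/cyclicP; exists (Zp1 : 'Z_4); exact: Zp_cycle.
  apply: isog_trans (isog_set1X _ _).
  rewrite (isog_abelem_card _ (abelemS sDB EB)) rV_Z2_abelem.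
  by rewrite card_rV_Z2 oD eqxx.
- rewrite (isog_abelem_card _ EB) rV_Z2_abelem card_rV_Z2 oB oD expnS eqxx //.
Qed.
End ExceptionalPair.

(** * Independent sets and counting by fibres *)

Section Finite.
Local Open Scope nat_scope.

Lemma leq_card_bigcup (I T : finType) (P : pred I) (F : I -> {set T}) :
  #|\bigcup_(i | P i) F i| <= \sum_(i | P i) #|F i|.
Proof.
elim/big_rec2: _ => [|i n X _ le]; first by rewrite cards0.
by apply: leq_trans (leq_card_setU _ _) _; rewrite leq_add2l.
Qed.

(** For a maximal independent [I] the neighbourhoods of its points cover [E], and each of them has
    at most [d] elements. *)
Lemma large_independent_set (T : finType) (e : rel T) (d : nat) (E : {set T}) :
    reflexive e -> symmetric e -> (forall t, #|[set u | e t u]| <= d) ->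
  exists2 I : {set T}, I \subset E &
    {in I &, forall t u, e t u -> t = u} /\ #|E| <= d * #|I|.
Proof.
move=> e_refl e_sym deg.
pose P (I : {set T}) :=
  (I \subset E) && [forall t in I, forall u in I, e t u ==> (t == u)].
have P0 : P set0.
  by rewrite /P sub0set; apply/forall_inP => t; rewrite inE.
have [I maxI _] := maxset_exists P0.
have [/andP[sIE /forall_inP indI] max] := maxsetP maxI.
have {}indI : {in I &, forall t u, e t u -> t = u}.
  by move=> t u It Iu; move/implyP: (forall_inP (indI t It) u Iu) => h /h/eqP.
exists I => //; split=> //.
have cov : E \subset \bigcup_(t in I) [set u | e t u].
  apply/subsetP=> u Eu; apply/bigcupP.
  have [Iu|Iu] := boolP (u \in I); first by exists u; rewrite ?inE.
  have [t /andP[It etu]|none] := pickP [pred t | (t \in I) && e t u].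
    by exists t; rewrite ?inE.
  case/negP: Iu; rewrite -(max (u |: I)) ?setU11 ?subsetUr //.
  rewrite /P subUset sub1set Eu sIE /=; apply/forall_inP => t It; apply/forall_inP => v Iv.
  apply/implyP => etv; apply/eqP; move: It Iv etv.
  have nI t' : t' \in I -> e t' u = false.
    by move=> It'; have := none t'; rewrite /= It'.
  case/setU1P=> [->|It] /setU1P[->|Iv] //; first by rewrite e_sym nI.
    by rewrite nI.
  exact: indI.
apply: leq_trans (subset_leq_card cov) _; rewrite mulnC -sum_nat_const.
by apply: leq_trans (leq_card_bigcup _ _) _; apply: leq_sum.
Qed.

Lemma card_fibers (T U : finType) (f : T -> U) (X : {set T}) (Y : {set U}) m :
    {in X, forall x, f x \in Y} ->
    {in X, forall x, #|[set y in X | f y == f x]| <= m} ->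
  #|X| <= #|Y| * m.
Proof.
move=> fXY fib; rewrite -sum1_card (partition_big f (mem Y)) //=.
rewrite -sum_nat_const; apply: leq_sum => y _.
rewrite sum1dep_card; have [->|[x]] := set_0Vmem [set x in X | f x == y].
  by rewrite cards0.
by rewrite inE => /andP[Xx /eqP<-]; exact: fib.
Qed.
End Finite.

(** * Generating sets of logarithmic size *)

Section Generators.
Local Open Scope group_scope.

(** Adjoining an element outside [<<s>>] at least doubles it, so among the [s] with
    [2 ^ #|s| <= #|<<s>>|] one that maximises [#|<<s>>|] generates the whole group. *)
Lemma small_generating_set (gT : finGroupType) :
  exists2 s : {set gT}, <<s>> = [set: gT] & (2 ^ #|s| <= #|gT|)%N.
Proof.
have P0 : (2 ^ #|@set0 gT| <= #|<<@set0 gT>>|)%N by rewrite cards0 cardG_gt0.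
pose P := [pred s : {set gT} | (2 ^ #|s| <= #|<<s>>|)%N].
have [s Ps max] := @arg_maxnP _ set0 P (fun s : {set gT} => #|<<s>>|) P0.
have s1 : <<s>> = [set: gT].
  apply/eqP; rewrite -subTset; apply/subsetP=> x _; apply/negPn/negP=> sx.
  have prop : <<s>> \proper <<x |: s>>.
    rewrite properE genS ?subsetUr //=; apply: contra sx => /subsetP; apply.
    by rewrite mem_gen ?setU11.
  have dbl : (2 * #|<<s>>| <= #|<<x |: s>>|)%N.
    rewrite -(Lagrange (proper_sub prop)) mulnC leq_mul2l indexg_gt1.
    by rewrite proper_subn ?orbT.
  have : P (x |: s).
    rewrite /= cardsU1 (contra (@mem_gen _ _ _)) //= expnS.
    by apply: leq_trans dbl; rewrite leq_mul2l.
  by move/max => /(leq_trans (proper_card prop)); rewrite ltnn.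
by exists s => //; move: Ps; rewrite /= s1 cardsT.
Qed.
End Generators.

(** * Connection sets, resolving sets and isomorphism classes *)

Section ConnectionSets.
Local Open Scope group_scope.
Variable A : finGroupType.
Implicit Types (B : {group A}) (S T : {set A}).

Definition connection_sets B : {set {set A}} :=
  [set S : {set A} | (S \subset [set: A] :\: B) && (S == S^-1)].

Lemma connection_setsP B S :
  reflect ({in S, forall x, x \notin B} /\ forall x, (x^-1 \in S) = (x \in S))
          (S \in connection_sets B).
Proof.
rewrite inE; apply: (iffP andP) => [[/subsetP SB /eqP Sinv]|[SB Sinv]]; split.
- by move=> x /SB; rewrite !inE andbT.
- by move=> x; rewrite -mem_invg -Sinv.
- by apply/subsetP=> x /SB; rewrite !inE andbT.
- by apply/eqP/setP=> x; rewrite mem_invg Sinv.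
Qed.

Lemma mem_Cay S x y : ((x, y) \in Cay S) = (x * y^-1 \in S).
Proof. by rewrite inE. Qed.

Lemma Cay_inj : injective (@Cay A).
Proof.
by move=> S T eqST; apply/setP=> x; rewrite -(mulg1 x) -invg1 -!mem_Cay eqST.
Qed.

Lemma bipartite_Cayley_graphsE B :
  bipartite_Cayley_graphs B = @Cay A @: connection_sets B.
Proof.
by apply/setP=> D; apply/imsetP/imsetP=> -[S SB ->]; exists S; rewrite // inE in SB *.
Qed.

(** Let [X] contain one element of each orbit of inversion outside [B]. Then [S] is determined by
    its trace on [X], which is arbitrary. The union of [X] and [X^-1] is A \ B and their
    intersection is A_2 \ B, whence the value of 2|X|. *)
Lemma card_connection_sets B :
  exists2 r : nat, #|connection_sets B| = (2 ^ r)%N &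
    (2 * r = #|[set: A] :\: B| + #|square_roots1 A :\: B|)%N.
Proof.
pose X := [set x : A | (x \notin B) && (enum_rank x <= enum_rank x^-1)%N].
have XV x : x \notin B -> (x \in X) || (x^-1 \in X).
  by move=> Bx; rewrite !inE groupV Bx invgK leq_total.
have XXV x : x \in X -> x^-1 \in X -> x^-1 = x.
  rewrite !inE invgK => /andP[_ le1] /andP[_ le2].
  by apply/enum_rank_inj/val_inj/eqP; rewrite /= eqn_leq le2 le1.
exists #|X|.
  rewrite -card_powerset.
  have inj : {in connection_sets B &, injective (fun S => S :&: X)}.
    move=> S T /connection_setsP[SB SV] /connection_setsP[TB TV] eqST.
    have eqX x : x \in X -> (x \in S) = (x \in T).
      by move=> Xx; move/setP/(_ x): eqST; rewrite !in_setI Xx !andbT.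
    apply/setP=> x; have [Bx|Bx] := boolP (x \in B).
      by apply/idP/idP=> [/SB|/TB]; rewrite Bx.
    by case/orP: (XV x Bx) => [/eqX //|/eqX]; rewrite SV TV.
  rewrite -(card_in_imset inj); apply: eq_card => J; apply/imsetP/idP.
    by case=> S _ ->; rewrite inE subsetIr.
  rewrite inE => /subsetP JX; exists (J :|: J^-1).
    apply/connection_setsP; split=> [x|x]; rewrite !inE ?invgK 1?orbC //.
    by case/orP=> /JX; rewrite !inE ?groupV => /andP[].
  apply/setP=> x; rewrite in_setI in_setU mem_invg.
  have [Jx|Jx] /= := boolP (x \in J); first by rewrite JX.
  apply/esym/negbTE/negP => /andP[JxV Xx]; case/negP: Jx.
  by rewrite -(XXV x Xx (JX _ JxV)).
rewrite mul2n -addnn -{1}(card_invg X) -(cardsUI X^-1 X) addnC [RHS]addnC.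
have sqrtE (x : A) : (x ^+ 2 == 1) = (x^-1 == x).
  by rewrite eq_invg_mul.
congr (_ + _)%N; apply: eq_card => x; last first.
  rewrite in_setU orbC mem_invg in_setD in_setT andbT.
  by case: (boolP (x \in B)) => [Bx|/XV ->] //; rewrite !inE groupV Bx.
rewrite in_setI andbC mem_invg in_setD [x \in square_roots1 A]inE sqrtE; apply/andP/andP=> -[].
  by move=> Xx XVx; rewrite (XXV x) //; split=> //; move: Xx; rewrite inE => /andP[].
by move=> Bx /eqP eqx; rewrite eqx !inE eqx Bx leqnn.
Qed.

Definition resolving S T : bool :=
  [forall x, forall y,
    [forall t in T, (x * t^-1 \in S) == (y * t^-1 \in S)] ==> (x == y)].

Lemma resolvingP S T :
  reflect (forall x y,
             {in T, forall t, (x * t^-1 \in S) = (y * t^-1 \in S)} -> x = y)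
          (resolving S T).
Proof.
apply: (iffP idP) => [res x y eqT|res].
  have /forallP/(_ x)/forallP/(_ y)/implyP h := res.
  by apply/eqP/h/forall_inP=> t /eqT->.
apply/forallP=> x; apply/forallP=> y; apply/implyP=> /forall_inP eqT.
by apply/eqP/res=> t /eqT/eqP.
Qed.

Definition Cay_iso S S0 (f : {perm A}) : bool :=
  [forall x, forall y, (x * y^-1 \in S) == (f x * (f y)^-1 \in S0)].

Lemma Cay_isoP S S0 (f : {perm A}) :
  reflect (forall x y, (x * y^-1 \in S) = (f x * (f y)^-1 \in S0))
          (Cay_iso S S0 f).
Proof.
apply: (iffP idP) => [iso x y|iso].
  by have /forallP/(_ x)/forallP/(_ y)/eqP := iso.
by apply/forallP=> x; apply/forallP=> y; rewrite iso.
Qed.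

Lemma digraph_iso_Cay S S0 :
  digraph_iso (Cay S) (Cay S0) = [exists f : {perm A}, Cay_iso S S0 f].
Proof.
apply/existsP/existsP=> -[f /forallP isof]; exists f.
  by apply/Cay_isoP=> x y; have /forallP/(_ y)/eqP := isof x; rewrite !mem_Cay.
apply/forallP=> x; apply/forallP=> y; rewrite !mem_Cay.
by have /forallP/(_ y) := isof x.
Qed.

(* Right multiplication by a is an automorphism of Cay(A,S); f carries it over to Cay(A,S0). *)
Definition transported_mul (f : {perm A}) (a x : A) : A := f (f^-1 x * a).

Lemma transported_mulM (f : {perm A}) a b x :
  transported_mul f (a * b) x = transported_mul f b (transported_mul f a x).
Proof. by rewrite /transported_mul permK mulgA. Qed.

Lemma transported_mulK (f : {perm A}) a :
  cancel (transported_mul f a) (transported_mul f a^-1).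
Proof.
by move=> x; rewrite -transported_mulM mulgV /transported_mul mulg1 permKV.
Qed.

Lemma transported_mul_aut S S0 (f : {perm A}) a x y : Cay_iso S S0 f ->
  (transported_mul f a x * (transported_mul f a y)^-1 \in S0) =
  (x * y^-1 \in S0).
Proof.
move/Cay_isoP=> isof; rewrite -isof invMg mulgA mulgK isof !permKV //.
Qed.

Lemma card_iso_class (S0 T X : {set A}) : resolving S0 T -> <<X>> = [set: A] ->
  (#|[set S | digraph_iso (Cay S) (Cay S0)]| <= #|A| * (#|A| ^ #|T|) ^ #|X|)%N.
Proof.
move=> /resolvingP res genX.
(* The default 1 is harmless: injectivity of [code] is claimed only where an isomorphism exists. *)
pose iso S := odflt 1 [pick f | Cay_iso S S0 f].
have isoP S : digraph_iso (Cay S) (Cay S0) -> Cay_iso S S0 (iso S).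
  rewrite digraph_iso_Cay /iso => /existsP[f isof].
  by case: pickP => [//|/(_ f)]; rewrite isof.
pose code S : A * {ffun {x | x \in X} -> {ffun {t | t \in T} -> A}} :=
  (iso S 1, [ffun a => [ffun t => transported_mul (iso S) (val a) (val t)]]).
have inj : {in [set S | digraph_iso (Cay S) (Cay S0)] &, injective code}.
  move=> S S'; rewrite !inE => /isoP iS /isoP iS' [eq1 /ffunP eqX].
  have eqTX a t : a \in X -> t \in T ->
      transported_mul (iso S) a t = transported_mul (iso S') a t.
    move=> Xa Tt; have /ffunP/(_ (exist _ t Tt)) := eqX (exist _ a Xa).
    by rewrite !ffunE.
  (* The elements on which the two actions agree everywhere form a subgroup, so it suffices to find
     the generators [X] in it. *)
  pose H := [set a | [forall x,
    transported_mul (iso S) a x == transported_mul (iso S') a x]].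
  have gH : group_set H.
    apply/group_setP; split.
      by rewrite inE; apply/forallP=> x; rewrite /transported_mul !mulg1 !permKV.
    move=> a b; rewrite !inE => /forallP Ha /forallP Hb; apply/forallP=> x.
    by rewrite !transported_mulM (eqP (Ha x)).
  have sXH : X \subset Group gH.
    apply/subsetP=> a Xa; rewrite inE; apply/forallP=> x.
    (* The second action sends [z] where the first sends [x]. Both act by automorphisms and agree on
       [T], so [z] and [x] have the same neighbours in [T] and are equal. *)
    pose z := transported_mul (iso S') a^-1 (transported_mul (iso S) a x).
    have az : transported_mul (iso S') a z = transported_mul (iso S) a x.
      by rewrite -{1}(invgK a) transported_mulK.
    rewrite -az (res x z) // => t Tt.
    rewrite -(transported_mul_aut a z t iS') az -eqTX //.
    by rewrite (transported_mul_aut _ _ _ iS).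
  (* Since [f a = transported_mul f a (f 1)], the action and the value at 1 recover the
     isomorphism. *)
  have eqiso a : iso S a = iso S' a.
    have : a \in Group gH by rewrite (subsetP _ a (in_setT a)) // -genX gen_subG.
    rewrite inE => /forallP/(_ (iso S 1))/eqP.
    by rewrite {2}eq1 /transported_mul !permK !mul1g.
  apply/setP=> x; rewrite -(mulg1 x) -invg1.
  by rewrite (Cay_isoP _ _ _ iS) (Cay_isoP _ _ _ iS') !eqiso.
rewrite -(card_in_imset inj); apply: leq_trans (max_card _) _.
by rewrite card_prod !card_ffun !card_sig.
Qed.

End ConnectionSets.

(** * Connection sets that leave a given pair of vertices unresolved *)

Section Resolving.
Local Open Scope group_scope.
Variables (A : finGroupType) (B : {group A}).
Hypothesis cAA : abelian [set: A].
Implicit Types (S T : {set A}).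

Let mulC (x y : A) : x * y = y * x.
Proof. by apply: (centsP cAA); rewrite inE. Qed.

(* For u <> t this says that, up to inversion, x/t or x/u occurs in both conditions
   "x/t in S iff y/t in S" and "x/u in S iff y/u in S". *)
Definition conflict (x y t u : A) : bool :=
  [|| u == t, u * t == x * x, y * u == x * t, x * u == y * t | u * t == x * y].

Let cross_mul (a b c d : A) : a * b^-1 = c * d^-1 -> a * d = c * b.
Proof.
move=> eq_ab; rewrite -[a](mulgKV b) eq_ab -!mulgA [b * d]mulC.
by rewrite mulKg.
Qed.

Lemma card_conflict x y t : (#|[set u | conflict x y t u]| <= 5)%N.
Proof.
(* Each of the five equations in [conflict] has a single solution [u]; these are listed in order. *)
pose s := [:: t; x * x * t^-1; y^-1 * (x * t); x^-1 * (y * t); x * y * t^-1].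
apply: leq_trans (_ : #|s| <= _)%N; last exact: card_size.
apply/subset_leq_card/subsetP=> u; rewrite !inE.
by case/or4P=> [/eqP->|/eqP<-|/eqP<-|/orP[]/eqP<-];
  rewrite ?eqxx ?mulgK ?mulKg ?eqxx ?orbT.
Qed.

Lemma conflict_sym x y : symmetric (conflict x y).
Proof.
move=> t u; rewrite /conflict eq_sym [t * u]mulC [y * t == _]eq_sym.
rewrite [x * t == _]eq_sym; congr [|| _, _ | _]; by rewrite orbCA.
Qed.

Definition unresolved_sets (x y : A) T : {set {set A}} :=
  [set S in connection_sets B |
    [forall t in T, (x * t^-1 \in S) == (y * t^-1 \in S)]].

(** A conflict-free subset keeps a fifth of [T], and each of its conditions halves the count. As
    [t * t != x * y], the quotients x/t and y/t are not mutually inverse; as x/t lies outside [B],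
    it may be toggled freely. *)
Lemma card_unresolved_sets (x y : A) T : x != y ->
    {in T, forall t, x * t^-1 \notin B} -> {in T, forall t, t * t != x * y} ->
  exists2 i, (#|T| <= 5 * i)%N &
    (#|unresolved_sets x y T| * 2 ^ i <= #|connection_sets B|)%N.
Proof.
move=> neq_xy TB Tsq.
have e_refl : reflexive (conflict x y) by move=> t; rewrite /conflict eqxx.
have [I /subsetP sIT [indI leTI]] :=
  large_independent_set T e_refl (conflict_sym x y) (card_conflict x y).
exists #|I| => //.
pose mask (J : {set A}) s := [exists t in J, (s == x * t^-1) || (s^-1 == x * t^-1)].
(* Toggling the orbits of x/t for t in J breaks exactly the conditions indexed by J,
   so J, and hence S, can be recovered from the outcome. *)
pose flip (SJ : {set A} * {set A}) := [set s | (s \in SJ.1) (+) mask SJ.2 s].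
have maskx (J : {set A}) u : J \subset I -> u \in I -> mask J (x * u^-1) = (u \in J).
  move=> /subsetP JI Iu; apply/exists_inP/idP=> [[t Jt]|Ju]; last first.
    by exists u; rewrite ?eqxx.
  rewrite (inj_eq (mulgI x)) (inj_eq invg_inj) invMg invgK.
  case/orP=> [/eqP-> //|/eqP eq_ut]; rewrite (indI u t (Iu) (JI t Jt)) //.
  by rewrite conflict_sym /conflict (cross_mul eq_ut) eqxx orbT.
have masky (J : {set A}) u : J \subset I -> u \in I -> mask J (y * u^-1) = false.
  move=> /subsetP JI Iu; apply/negbTE/exists_inP=> -[t Jt].
  have It := JI t Jt.
  rewrite invMg invgK; case/orP=> /eqP eq_ut.
    have eq1 : x * u = y * t by apply/esym/cross_mul.
    have eqtu : u = t.
      by apply: indI => //; rewrite conflict_sym /conflict eq1 eqxx !orbT.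
    by move/eqP: neq_xy; apply; apply: (mulIg t); rewrite -eq1 eqtu.
  have eq1 : u * t = x * y by apply: cross_mul.
  have eqtu : u = t.
    by apply: indI => //; rewrite conflict_sym /conflict eq1 eqxx !orbT.
  by move/eqP: (Tsq t (sIT t It)); apply; rewrite -eq1 eqtu.
have inj : {in setX (unresolved_sets x y T) (powerset I) &, injective flip}.
  have rec S (J : {set A}) u : S \in unresolved_sets x y T -> J \subset I -> u \in I ->
      (u \in J) = (x * u^-1 \in flip (S, J)) (+) (y * u^-1 \in flip (S, J)).
    rewrite inE => /andP[_ /forall_inP bad] JI Iu.
    rewrite !inE /= maskx // masky // (eqP (bad u (sIT u Iu))) addbF.
    by rewrite addbC addbA addbb.
  move=> [S J] [S' J'] /setXP[/= bS]; rewrite inE => JI /setXP[/= bS'].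
  rewrite inE => J'I eqf.
  have eqJ : J = J'.
    apply/setP=> u; have [Iu|Iu] := boolP (u \in I).
      by rewrite (rec S) // (rec S' J') // eqf.
    by rewrite (contraNF (subsetP JI u) Iu) (contraNF (subsetP J'I u) Iu).
  congr (_, _) => //; apply/setP=> s; move/setP/(_ s): eqf.
  by rewrite !inE /= eqJ => /addIb.
rewrite -card_powerset -cardsX -(card_in_imset inj).
apply/subset_leq_card/subsetP=> _ /imsetP[[S J] /setXP[/= bS JI] ->].
move: bS JI; rewrite [S \in _]inE => /andP[/connection_setsP[SB SV] _].
rewrite inE => /subsetP JI.
apply/connection_setsP; split=> [s|s]; rewrite !inE /=; last first.
  rewrite SV; congr (_ (+) _); apply: eq_existsb => t.
  by rewrite invgK orbC.
have [/SB //|_ /=] := boolP (s \in S).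
case/exists_inP=> t /JI/sIT/TB nB /orP[]/eqP e; first by rewrite e.
by rewrite -groupV e.
Qed.

End Resolving.

(** * Most connection sets are resolved; bounds on the number of classes *)

Section Counting.
Local Open Scope group_scope.
Variables (A : finGroupType) (B : {group A}).

Lemma square_separating_shift : admissible_pair B -> (4 < #|A|)%N ->
  exists2 g : A, g \in B &
    forall x y t : A, x != y -> t * t = x * y -> (g * t) * (g * t) <> x * y.
Proof.
case=> cAA iB2 nexc An4.
have mulC (x y : A) : x * y = y * x by apply: (centsP cAA); rewrite inE.
have [g /andP[Bg g2]|B2] := pickP [pred b | (b \in B) && (b ^+ 2 != 1)].
  exists g => // x y t _ <- eqt; case/negP: g2; apply/eqP.
  apply: (mulIg (t * t)); rewrite mul1g -[RHS]eqt expg2.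
  by rewrite -[in RHS]mulgA [t * (g * t)]mulC -!mulgA.
have A2 (a : A) : a * a = 1.
  apply/eqP; have [//|a2] := eqVneq (a * a) 1; case: nexc.
  apply: exceptional_pair_elementary => //; last by exists a; rewrite expg2.
  by move=> b Bb; apply/eqP; have := B2 b; rewrite /= Bb /= => /negbFE.
(* Now [A] is elementary abelian, so [t * t = x * y] would force [x = y], and the trivial shift
   serves. *)
exists 1 => // x y t /eqP neq; rewrite A2 => eq1; case: neq.
by apply: (mulIg y); rewrite -eq1 A2.
Qed.

(** The factor 10 in [K] pays for the half of the conditions lost to squares and the four fifths
    lost to conflicts. The remaining [(2 * L).+1] independent conditions beat the at most
    [2 ^ (2 * L)] pairs by a factor 2, so at most half of the sets are bad. *)
Lemma many_resolved_sets (L : nat) : admissible_pair B -> (4 < #|A|)%N ->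
    (#|A| <= 2 ^ L)%N -> (10 * (2 * L).+1 <= #|B|)%N ->
  exists2 T : {set A}, (#|T| <= 40 * (2 * L).+1)%N &
    (#|connection_sets B| <=
       2 * #|[set S in connection_sets B | resolving S T]|)%N.
Proof.
move=> adm An4 leAL; set K := (10 * _)%N => leK.
have [g Bg gP] := square_separating_shift adm An4.
have [cAA iB2 _] := adm.
have mulC (x y : A) : x * y = y * x by apply: (centsP cAA); rewrite inE.
have [T1 sT1 oT1] : exists2 T1 : {set A}, T1 \subset B & #|T1| = K.
  have /card_geqP[s [s_uniq s_size sB]] := leK.
  exists [set x in s]; first by apply/subsetP=> x; rewrite inE => /sB.
  by rewrite cardsE (card_uniqP s_uniq).
have [a Ba] : exists a, a \notin B.
  have : (0 < #|[set: A] :\: B|)%N by rewrite card_index2D ?cardG_gt0.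
  by case/card_gt0P=> a; rewrite !inE andbT; exists a.
(* [T0] pairs each [t] with [g * t], at most one of which is lost to squares. The translate by [a]
   serves the [x] in [B], for which [t] must lie outside [B]. *)
pose T0 := T1 :|: g *: T1.
pose T := T0 :|: a *: T0.
have oT0 : (#|T0| <= 2 * K)%N.
  by apply: leq_trans (leq_card_setU _ _) _; rewrite card_lcoset oT1 mul2n addnn.
have sT0 : {in T0, forall t, t \in B}.
  move=> t /setUP[/(subsetP sT1) //|]; rewrite mem_lcoset => /(subsetP sT1).
  by rewrite groupMl ?groupV.
exists T.
  apply: leq_trans (leq_card_setU _ _) _; rewrite card_lcoset addnn -mul2n.
  by move: oT0; rewrite /K; lia.
have few (x y : A) : x != y ->
    (#|unresolved_sets B x y T| * 2 ^ (2 * L).+1 <= #|connection_sets B|)%N.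
  move=> neq.
  have [c xcB sT] : exists2 c : A, x * c^-1 \notin B & c *: T0 \subset T.
    have [Bx|Bx] := boolP (x \in B); [exists a | exists 1].
    - by rewrite groupMl ?groupV.
    - exact: subsetUr.
    - by rewrite invg1 mulg1.
    - by rewrite lcoset1; exact: subsetUl.
  pose E := [set t in c *: T0 | t * t != x * y].
  have EB : {in E, forall t, x * t^-1 \notin B}.
    move=> t; rewrite inE mem_lcoset => /andP[/sT0 Bct _].
    apply: contra xcB => Bxt.
    by rewrite -(mulgKV t x) -mulgA groupM // mulC.
  have E2 : {in E, forall t, t * t != x * y} by move=> t; rewrite inE => /andP[].
  have oE : (K <= 2 * #|E|)%N.
    (* For [t] in [T1], at least one of [c * t] and [c * g * t] survives in [E]. *)
    have sub : T1 \subset c^-1 *: E :|: (c * g)^-1 *: E.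
      apply/subsetP=> t Tt; rewrite inE !mem_lcoset !invgK !inE.
      rewrite !mem_lcoset mulKg !inE Tt /= -!mulgA mulKg !mem_lcoset mulKg Tt orbT /=.
      have [eqt|//] := eqVneq (c * (t * (c * t))) (x * y).
      have := gP x y (c * t) neq; rewrite -!mulgA => /(_ eqt)/eqP.
      by rewrite !(mulgA g c) (mulC g c) !mulgA.
    rewrite -oT1; apply: leq_trans (subset_leq_card sub) _.
    by apply: leq_trans (leq_card_setU _ _) _; rewrite !card_lcoset mul2n addnn.
  have [i leEi leUi] := card_unresolved_sets cAA neq EB E2.
  apply: leq_trans leUi; apply: leq_mul; last first.
    rewrite leq_exp2l //; have := leq_trans oE (leq_mul (leqnn 2) leEi).
    by rewrite /K; lia.
  apply/subset_leq_card/subsetP=> S; rewrite !inE => /andP[-> /forall_inP unr].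
  apply/forall_inP=> t; rewrite inE => /andP[cT _].
  exact/unr/(subsetP sT).
set Good := [set S in _ | _].
pose Bad := \bigcup_(xy : A * A | xy.1 != xy.2) unresolved_sets B xy.1 xy.2 T.
have cov : connection_sets B \subset Good :|: Bad.
  apply/subsetP=> S SB; rewrite in_setU inE SB /=.
  have [//|] := boolP (resolving S T).
  rewrite negb_forall => /existsP[x]; rewrite negb_forall => /existsP[y].
  rewrite negb_imply => /andP[unr neq]; apply/bigcupP; exists (x, y) => //.
  by rewrite inE SB.
have oBad : (#|Bad| * 2 ^ (2 * L).+1 <= 2 ^ (2 * L) * #|connection_sets B|)%N.
  apply: leq_trans (_ : \sum_(xy : A * A) #|connection_sets B| <= _)%N.
    apply: leq_trans (leq_mul (leq_card_bigcup _ _) (leqnn _)) _.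
    rewrite big_distrl /= [X in (_ <= X)%N](bigID (fun xy => xy.1 != xy.2)) /=.
    by apply: leq_trans (leq_addr _ _); apply: leq_sum => xy /few.
  rewrite sum_nat_const card_prod leq_mul2r mul2n -addnn expnD.
  by rewrite leq_mul ?orbT.
have := leq_trans (subset_leq_card cov) (leq_card_setU _ _).
rewrite expnS in oBad.
have p0 : (0 < 2 ^ (2 * L))%N by rewrite expn_gt0.
nia.
Qed.

Lemma num_iso_classes_upper :
  (num_iso_classes (bipartite_Cayley_graphs B) <= #|connection_sets B|)%N.
Proof.
apply: leq_trans (leq_imset_card _ _) _.
by rewrite bipartite_Cayley_graphsE leq_imset_card.
Qed.

(** Sets in one fibre of [cls] give isomorphic graphs, so [card_iso_class] bounds every fibre
    through a resolved set. *)
Lemma num_iso_classes_lower T X : <<X>> = [set: A] ->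
  (#|[set S in connection_sets B | resolving S T]| <=
     num_iso_classes (bipartite_Cayley_graphs B)
       * (#|A| * (#|A| ^ #|T|) ^ #|X|))%N.
Proof.
move=> genX; set G := bipartite_Cayley_graphs B.
pose cls S := [set E in G | digraph_iso (Cay S) E].
have inG S : S \in connection_sets B -> Cay S \in G.
  by move=> SB; rewrite /G bipartite_Cayley_graphsE imset_f.
have clsE S D : (D \in cls S) = (D \in G) && digraph_iso (Cay S) D.
  by rewrite in_set.
have refl S : digraph_iso (Cay S) (Cay S).
  by have [] := digraph_iso_equivalence (Cay S) (Cay S) (Cay S).
apply: (card_fibers (f := cls)) => S; rewrite inE => /andP[SB resS].
  by apply: imset_f; exact: inG.
apply: leq_trans (card_iso_class resS genX).
apply/subset_leq_card/subsetP=> S'; rewrite !inE => /andP[/andP[SB' _] /eqP].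
by move/setP/(_ (Cay S)); rewrite !clsE inG // refl.
Qed.
End Counting.

(** * Numerical estimates *)

Section Logarithms.
Local Open Scope nat_scope.

(** This makes [B] large enough for [many_resolved_sets]. The induction starts at [L = 10] with 420
    <= 512; each step adds 40 on the left and doubles the right. *)
Lemma linear_leq_exp2 L : 9 < L -> 20 * (2 * L).+1 <= 2 ^ L.-1.
Proof.
elim: L => // L IH; rewrite leq_eqVlt => /orP[/eqP <- //|L9] /=.
by case: L IH L9 => // L IH L9; have := IH L9; rewrite /= expnS; lia.
Qed.

(** This is the fourth power of [L <= 4 * 2 ^ (L %/ 4)]. It will show that the cube of the logarithm
    is negligible against |A|. *)
Lemma pow4_leq_exp2 L : L ^ 4 <= 256 * 2 ^ L.
Proof.
have lt_exp k : k.+1 <= 2 ^ k by rewrite ltn_expl.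
have le4 : L <= 4 * 2 ^ (L %/ 4).
  by have := lt_exp (L %/ 4); have := divn_eq L 4; have := @ltn_pmod L 4 isT; lia.
apply: leq_trans (_ : (4 * 2 ^ (L %/ 4)) ^ 4 <= _); first by rewrite leq_exp2r.
by rewrite expnMn -expnM leq_mul2l leq_exp2l //= leq_divM.
Qed.

Lemma leq_expl m n e : m <= n -> m ^ e <= n ^ e.
Proof. by case: e => // e; rewrite leq_exp2r. Qed.

Section Bounds.
Variables (A : finGroupType) (B : {group A}).
Hypothesis adm : admissible_pair B.
(** The successor gives [2 ^ L.-1 <= #|A| < 2 ^ L]. *)
Let L := (trunc_log 2 #|A|).+1.

Lemma num_iso_classes_gt0 : 0 < num_iso_classes (bipartite_Cayley_graphs B).
Proof.
apply/card_gt0P; eexists; apply: imset_f.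
rewrite bipartite_Cayley_graphsE; apply: (imset_f _ (x := set0)).
by apply/connection_setsP; split=> x; rewrite !inE.
Qed.

Lemma connection_sets_leq_num_iso_classes : 9 < L ->
  #|connection_sets B| <=
    num_iso_classes (bipartite_Cayley_graphs B) * 2 ^ (122 * L ^ 3).
Proof.
move=> L9.
have A0 : 0 < #|A| by apply/card_gt0P; exists 1%g.
have leA : 2 ^ L.-1 <= #|A| by exact: trunc_logP.
have ltA : #|A| < 2 ^ L by exact: trunc_log_ltn.
have leL := linear_leq_exp2 L9.
have [cAA iB2 _] := adm; have oA := card_index2 iB2.
have An4 : 4 < #|A| by lia.
have leB : 10 * (2 * L).+1 <= #|B| by lia.
have [T oT many] := many_resolved_sets adm An4 (ltnW ltA) leB.
have [X genX oX] := small_generating_set A.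
have leX : #|X| <= L.
  by rewrite -(@leq_exp2l 2) // (leq_trans oX) // ltnW.
have low := num_iso_classes_lower B T genX.
apply: leq_trans many _; apply: leq_trans (leq_mul (leqnn 2) low) _.
rewrite mulnCA leq_mul2l; apply/orP; right.
(* The exponent of 2 is 80 L^3 + 40 L^2 + L + 1, at most (80 + 40 + 1 + 1) L^3; hence 122. *)
apply: leq_trans (_ : 2 * (2 ^ L * ((2 ^ L) ^ (40 * (2 * L).+1)) ^ L) <= _).
  rewrite leq_mul2l /=; apply: leq_mul; first exact: ltnW.
  apply: leq_trans (_ : ((2 ^ L) ^ (40 * (2 * L).+1)) ^ #|X| <= _).
    apply/leq_expl/(leq_trans (leq_expl _ (ltnW ltA))).
    by rewrite leq_pexp2l ?expn_gt0.
  by rewrite leq_pexp2l ?expn_gt0.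
rewrite -!expnM -expnD -expnS leq_exp2l //.
nia.
Qed.
End Bounds.
End Logarithms.

(** * The asymptotic formula *)

Theorem theorem1p13 (R : realType) :
  exists err : forall A : finGroupType, {group A} -> R,
    (forall eps : R, 0 < eps ->
       exists N : nat, forall (A : finGroupType) (B : {group A}),
         admissible_pair B -> (N <= #|A|)%N ->
         `|err A B / #|A|%:R| < eps)
    /\
    (forall (A : finGroupType) (B : {group A}),
       admissible_pair B ->
       (num_iso_classes (bipartite_Cayley_graphs B))%:R =
       2 `^ (#|A|%:R / 4 + #|square_roots1 A :\: B|%:R / 2 + err A B)).
Proof.
have ln2 : 0 < ln (2 : R) by rewrite ln_gt0 // ltr1n.
pose num (A : finGroupType) (B : {group A}) : R :=
  (num_iso_classes (bipartite_Cayley_graphs B))%:R.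
(* The error is chosen to make the formula exact, so only its size requires the bounds. *)
exists (fun A B => ln (num A B) / ln 2
                   - (#|A|%:R / 4 + #|square_roots1 A :\: B|%:R / 2)).
split=> [eps eps0|A B adm]; last first.
  rewrite addrC subrK /powR pnatr_eq0 /= mulfVK ?lnK ?gt_eqF //.
  by rewrite posrE ltr0n num_iso_classes_gt0.
have [C leC] : exists C, forall l n,
    (2 ^ l <= 2 * n)%N -> (122 * l ^ 3 * l <= C * n)%N.
  by exists (244 * 256)%N => l n; have := pow4_leq_exp2 l; rewrite expnS; lia.
have /archi_boundP : 0 <= C%:R / eps by rewrite divr_ge0 ?ler0n ?ltW.
set M := Num.bound _ => ltM.
(* This yields [M + 9 < L]: the 9 allows the lower bound on the number of classes, and [M] gives C /
   eps < L. *)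
exists (2 ^ (M + 9))%N => A B adm leA.
set L := (trunc_log 2 #|A|).+1.
have A0 : (0 < #|A|)%N by apply/card_gt0P; exists 1%g.
have LM : (M + 9 < L)%N.
  by rewrite ltnS -(@trunc_expnK 2 (M + 9) isT) leq_trunc_log.
have L9 : (9 < L)%N by apply: leq_trans LM; rewrite ltnS leq_addl.
have [r or r2] := card_connection_sets B.
have [cAA iB2 _] := adm; have oA := card_index2 iB2.
have rE : #|A|%:R / 4 + #|square_roots1 A :\: B|%:R / 2 = r%:R :> R.
  have : (2 * r)%:R = (#|B| + #|square_roots1 A :\: B|)%:R :> R.
    by rewrite r2 card_index2D.
  by rewrite oA natrD !natrM; lra.
have n0 := num_iso_classes_gt0 B; have num0 : 0 < num A B by rewrite ltr0n.
have up : ln (num A B) <= r%:R * ln 2.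
  rewrite mulr_natl -lnXn ?ltr0n // ler_ln ?posrE ?exprn_gt0 ?ltr0n //.
  by rewrite -natrX ler_nat -or num_iso_classes_upper.
have low : r%:R * ln 2 <= ln (num A B) + (122 * L ^ 3)%:R * ln 2.
  rewrite !mulr_natl -!lnXn ?ltr0n // -lnM ?posrE ?exprn_gt0 ?ltr0n //.
  rewrite ler_ln ?posrE ?mulr_gt0 ?exprn_gt0 ?ltr0n //.
  by rewrite -!natrX -natrM ler_nat -or connection_sets_leq_num_iso_classes.
rewrite /= rE normrM normfV normr_nat ltr_pdivrMr ?ltr0n //.
rewrite -(ltr_pM2r ln2).
have -> : `|ln (num A B) / ln 2 - r%:R| * ln 2 = r%:R * ln 2 - ln (num A B).
  rewrite ler0_norm; last by rewrite subr_le0 ler_pdivrMr.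
  by field; rewrite gt_eqF.
apply: le_lt_trans (_ : _ <= (122 * L ^ 3)%:R * ln 2) _; first by rewrite lerBlDl.
rewrite ltr_pM2r //.
have leA' : (2 ^ L <= 2 * #|A|)%N by rewrite expnS leq_mul2l /= trunc_logP.
have epsL : C%:R < eps * L%:R.
  rewrite mulrC -ltr_pdivrMr //; apply: lt_trans ltM _.
  by rewrite ltr_nat; apply: leq_trans LM; rewrite ltnS leq_addr.
have L0 : 0 < L%:R :> R by rewrite ltr0n.
(* After multiplication by [L] the chain is 122 L^4 <= C |A| < eps L |A|. *)
rewrite -(ltr_pM2r L0) -natrM.
apply: le_lt_trans (_ : _ <= (C * #|A|)%:R) _; first by rewrite ler_nat leC.
by rewrite natrM mulrAC ltr_pM2r ?ltr0n.
Qed.
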